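(* Fix a real number $p\ge1$. For integers $n\ge2$ let $$f_1(n)=\frac1n\, e^{\frac{(p-1)n}{p}}\Big(\frac{(p-1)n}{p}\Big)^{\frac np}\Gamma\Big(1-\frac np,\frac{(p-1)n}{p}\Big),\qquad f_2(n)=1-\frac{p}{n-1}\,\frac{\Gamma(\frac{n+p-2}{p})\,\Gamma(\frac np)}{\Gamma(\frac{n-1}{p})^2},$$ where for $p=1$ the expression $f_1(n)$ is interpreted as its limit as $p\to1^+$, which equals $0$. Then, as $n\to+\infty$, $$f_1(n)=\frac{p-1}{np}+o\Big(\frac1n\Big)\qquad\text{and}\qquad f_2(n)=\frac{p-1}{np}+o\Big(\frac1n\Big).$$
   Context: $\Gamma(\cdot)$ is the Gamma function and $\Gamma(s,x)=\int_x^{+\infty}t^{s-1}e^{-t}\,dt$ ($s\in\mathbb{R}$, $x>0$) is the upper incomplete gamma function. *)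

(* Defs.v *)
From HB Require Import structures.
From mathcomp Require Import all_boot all_order all_algebra.
From mathcomp Require Import all_classical all_reals all_analysis.

Set Implicit Arguments.
Unset Strict Implicit.
Unset Printing Implicit Defensive.

Import Order.TTheory GRing.Theory Num.Theory.
Import numFieldNormedType.Exports.

Local Open Scope classical_set_scope.
Local Open Scope ring_scope.

(* Euler's integral: this is the Gamma function on 0 < s only (for s <= 0 the
   integral diverges and Rintegral returns 0). *)
Definition Gamma (R : realType) (s : R) : R :=
  \int[lebesgue_measure]_(t in `]0, +oo[) (t `^ (s - 1) * expR (- t)).

(* The integral converges for every real s when 0 < x. *)
Definition upper_Gamma (R : realType) (s x : R) : R :=
  \int[lebesgue_measure]_(t in `[x, +oo[) (t `^ (s - 1) * expR (- t)).

(* Only meaningful for 1 < p: at p = 1 it involves upper_Gamma (1 - n) 0, a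
   divergent integral, whence the limit convention in f1. *)
Definition f1_formula (R : realType) (p : R) (n : nat) : R :=
  n%:R^-1 * expR ((p - 1) * n%:R / p)
  * ((p - 1) * n%:R / p) `^ (n%:R / p)
  * upper_Gamma (1 - n%:R / p) ((p - 1) * n%:R / p).

Definition f1 (R : realType) (p : R) (n : nat) : R :=
  if p == 1 then lim (f1_formula q n @[q --> 1^'+]) else f1_formula p n.

Definition f2 (R : realType) (p : R) (n : nat) : R :=
  1 - p / (n%:R - 1)
      * (Gamma ((n%:R + p - 2) / p) * Gamma (n%:R / p)
         / Gamma ((n%:R - 1) / p) ^+ 2).

(* Main.v *)
Require Import Defs.
From HB Require Import structures.
From mathcomp Require Import all_boot all_order all_algebra.
From mathcomp Require Import all_classical all_reals all_analysis.
From mathcomp Require Import ring lra measurable_realfun.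

Set Implicit Arguments.
Unset Strict Implicit.
Unset Printing Implicit Defensive.

Import Order.TTheory GRing.Theory Num.Theory.
Import numFieldNormedType.Exports.

Local Open Scope classical_set_scope.
Local Open Scope ring_scope.

(** Both expansions come from explicit two-sided bounds, valid for all large n:

    0 <= f n - (p - 1) / (n p) <= 1 / (n (n - 1)).

    For f1 with p > 1, put a = n / p and x = (p - 1) n / p, so that x + a = n.
    The function H t = t ^ (1 - a) exp (- t) / (t + a) has derivative - t ^ (-
    a) exp (- t) (1 - a / (t + a) ^ 2), so that - H is almost an antiderivative
    of t ^ (- a) exp (- t). Integrated from x to infinity, this traps Gamma (1
    - a, x) between H x and H x / (1 - 1 / (n p)) (upper_Gamma_bounds), and the
    prefactor of f1 turns H x into (p - 1) / (n p). The bounds also force the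
    limit 0 as p tends to 1.

    For f2, put s = (n - 1) / p, c = 1 / p and d = c (1 - c). Then f2 = 1 - r s
    with r s = Gamma (s + c) Gamma (s + 1 - c) / (s Gamma s ^ 2). The
    functional equation gives r (s + 1) = r s (1 + d / (s (s + 1))), and r (s +
    k) tends to 1 as k grows by Wendel's inequality Gamma (s + c) <= s ^ c
    Gamma s (Gamma_le_powR), which follows from the concavity of t ^ c. The
    explicit functions 1 - d / s and s / (s + d) satisfy the same recurrence up
    to an error of fixed sign and tend to 1 as well, whence 1 - d / s <= r s <=
    s / (s + d) (shift_ratio_lower, shift_ratio_upper). These bounds agree to
    first order in 1 / s. *)

(** * Powers, exponentials and integration on half-lines *)

Lemma continuous_powR_gt0 (R : realType) (s t : R) :
  0 < t -> {for t, continuous (@powR R ^~ s)}.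
Proof.
move=> t0; apply: differentiable_continuous; apply/derivable1_diffP.
by apply: derivable_powR; rewrite in_itv/= andbT.
Qed.

(** Powers grow more slowly than exponentials, with an explicit constant that
    holds down to t = 0. *)
Lemma powR_le_expR (R : realType) (s c t : R) :
  0 < s -> 0 < c -> 0 <= t -> t `^ s <= (s / c) `^ s * expR (c * t).
Proof.
move=> s0 c0 t0.
have -> : expR (c * t) = expR (c * t / s) `^ s.
  by rewrite -expRM mulfVK ?gt_eqF.
rewrite -powRM ?expR_ge0 ?divr_ge0 ?(ltW s0) ?(ltW c0)//.
apply: (ge0_ler_powR (ltW s0));
  rewrite ?nnegrE ?mulr_ge0 ?invr_ge0 ?expR_ge0 ?(ltW s0) ?(ltW c0)//.
(* 1 + u <= exp u, applied to u = c t / s and raised to the power s *)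
have h := expR_ge1Dx (c * t / s).
apply: (@le_trans _ _ (s / c * (c * t / s))).
  by rewrite le_eqVlt; apply/orP; left; apply/eqP; field; rewrite !gt_eqF.
by apply: ler_wpM2l; [rewrite divr_ge0 ?ltW|lra].
Qed.

Lemma cvg_expRN (R : realType) (a : R) :
  expR (- t) @[t --> a] --> expR (- a).
Proof.
by apply: (continuous_comp (f := -%R) (g := @expR R));
  [exact: continuousN|exact: continuous_expR].
Qed.

Lemma cvg_expRMNy (R : realType) (c : R) : 0 < c ->
  expR (- (c * t)) @[t --> +oo] --> (0 : R).
Proof.
move=> c0; apply: (@cvg_comp _ _ _ (fun t => c * t) (fun t => expR (- t))
  _ (+oo : set_system R)).
  by apply: gt0_cvgMry => //; exact: cvg_id.
exact: cvgr_expR.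
Qed.

Lemma is_derive_expRN (R : realType) (t : R) :
  is_derive t 1 (fun t : R => expR (- t)) (- expR (- t)).
Proof.
have h := @is_derive1_comp R (@expR R) -%R t _ _ (is_derive_expR _)
  (is_deriveN (is_derive_id t 1)).
by apply: (is_derive_eq h); rewrite mulrN1.
Qed.

Lemma is_derive_expRMN (R : realType) (c t : R) :
  is_derive t 1 (fun t : R => expR (- (c * t))) (- c * expR (- (c * t))).
Proof.
have hc : is_derive t 1 (fun t : R => - (c * t)) (- c).
  have := is_deriveN (is_deriveZ c (is_derive_id t 1)).
  by rewrite /GRing.scale/= mulr1.
have h := @is_derive1_comp R (@expR R) _ t _ _ (is_derive_expR _) hc.
by apply: (is_derive_eq h); rewrite mulrC.
Qed.

(** Concavity of u ^ c: its graph lies below the tangent at u = 1. *)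
Lemma powR_le_tangent (R : realType) (c u : R) : 0 <= c <= 1 -> 0 < u ->
  u `^ c <= 1 - c + c * u.
Proof.
move=> /andP[c0 c1] u0; rewrite /powR gt_eqF//.
(* With m = c ln u: exp v >= exp m * (1 + v - m) at v = 0 and at v = ln u,
   averaged with weights 1 - c and c; the mean of v is m, so this gives exp m. *)
set m := c * ln u; rewrite -[X in _ <= _ + c * X](lnK (u0 : u \is Num.pos)).
have h1 : expR m * (1 - m) <= 1.
  by rewrite -[leRHS](expRxMexpNx_1 m) ler_wpM2l ?expR_ge0// expR_ge1Dx.
have h2 : expR m * (1 + (ln u - m)) <= expR (ln u).
  have -> : expR (ln u) = expR m * expR (ln u - m).
    by rewrite -expRD addrC subrK.
  by rewrite ler_wpM2l ?expR_ge0// expR_ge1Dx.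
have h3 : (1 - c) * (expR m * (1 - m)) <= (1 - c) * 1.
  by rewrite ler_wpM2l// subr_ge0.
have h4 := ler_wpM2l c0 h2.
have h5 := lerD h3 h4; rewrite mulr1 in h5; apply: le_trans h5.
by rewrite le_eqVlt; apply/orP; left; apply/eqP; rewrite /m; ring.
Qed.

(** The fundamental theorem of calculus on a half-line, with the continuity
    hypotheses separated into the open half-line and its endpoint. *)
Lemma ge0_integral_antiderivative (R : realType) (f F : R -> R) (a l : R) :
  (forall t, a <= t -> 0 <= f t) ->
  (forall t, a < t -> {for t, continuous f}) ->
  f t @[t --> a^'+] --> f a ->
  (forall t, a < t -> is_derive t 1 F (f t)) ->
  F t @[t --> a^'+] --> F a ->
  F t @[t --> +oo] --> l ->
  (\int[lebesgue_measure]_(t in `[a, +oo[) (f t)%:E = (l - F a)%:E)%E.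
Proof.
move=> f0 cf fa dF Fa Fl; rewrite EFinB; apply: ge0_continuous_FTC2y => //.
- apply/continuous_within_itvcyP; split => // t.
  by rewrite in_itv/= andbT; exact: cf.
- by move=> t at0; have [] := dF t at0.
- move=> t; rewrite in_itv/= andbT => at0; have d := dF t at0.
  by rewrite derive1E; exact: derive_val.
Qed.

(** * The integrand of the Gamma functions *)

Definition gamma_integrand (R : realType) (s t : R) : R :=
  t `^ (s - 1) * expR (- t).

Lemma gamma_integrand_ge0 (R : realType) (s t : R) : 0 <= gamma_integrand s t.
Proof. by rewrite mulr_ge0 ?powR_ge0 ?expR_ge0. Qed.

Lemma measurable_gamma_integrand (R : realType) (D : set R) (s : R) :
  measurable_fun D (gamma_integrand s).
Proof.
apply: measurable_funTS; apply: measurable_funM; first exact: measurable_powR.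
by apply: measurableT_comp => //; exact: measurableT_comp.
Qed.

Lemma continuous_gamma_integrand (R : realType) (s t : R) :
  0 < t -> {for t, continuous (gamma_integrand s)}.
Proof.
move=> t0; apply: cvgM; first exact: continuous_powR_gt0.
apply: (continuous_comp (f := -%R) (g := @expR R)); first exact: continuousN.
exact: continuous_expR.
Qed.

Lemma gamma_integrandS (R : realType) (s t : R) :
  0 < t -> gamma_integrand (s + 1) t = t * gamma_integrand s t.
Proof.
move=> t0; rewrite /gamma_integrand mulrA; congr (_ * _).
have -> : s + 1 - 1 = 1 + (s - 1) by ring.
by rewrite (@powRD _ t 1) ?(gt_eqF t0) ?implybT// powRr1// ltW.
Qed.

Lemma is_derive_gamma_integrand (R : realType) (s t : R) : 0 < t ->
  is_derive t 1 (gamma_integrand (s + 1))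
    (s * gamma_integrand s t - gamma_integrand (s + 1) t).
Proof.
move=> t0.
have := is_deriveM (is_derive1_powR s t0) (is_derive_expRN t).
have -> : (@powR R ^~ s * fun u => expR (- u)) = gamma_integrand (s + 1).
  by rewrite funeqE => u; rewrite /gamma_integrand addrK.
move=> h; apply: (is_derive_eq h).
rewrite /gamma_integrand addrK /GRing.scale/=; ring.
Qed.

Lemma gamma_integrand_cvg0 (R : realType) (s : R) : 1 < s ->
  gamma_integrand s t @[t --> 0^'+] --> gamma_integrand s 0.
Proof.
move=> s1; apply: cvgM.
  by rewrite powR0; [apply: powR_cvg0|]; rewrite ?subr_gt0// gt_eqF// subr_gt0.
exact/cvg_at_right_filter/cvg_expRN.
Qed.

(** Half of the exponential decay absorbs the power of t. *)
Lemma gamma_integrand_le (R : realType) (s t : R) : 1 < s -> 0 <= t ->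
  gamma_integrand s t <= ((s - 1) / 2^-1) `^ (s - 1) * expR (- (2^-1 * t)).
Proof.
move=> s1 t0; rewrite /gamma_integrand.
have -> : - t = - (2^-1 * t) - 2^-1 * t by lra.
rewrite expRD mulrCA mulrC; apply: ler_wpM2r; first exact: expR_ge0.
rewrite expRN ler_pdivrMr ?expR_gt0//.
by apply: powR_le_expR => //; rewrite ?subr_gt0// invr_gt0.
Qed.

Lemma gamma_integrand_cvgy (R : realType) (s : R) : 1 < s ->
  gamma_integrand s t @[t --> +oo] --> 0.
Proof.
move=> s1; apply: (@squeeze_cvgr _ _ _ _ (cst 0)
    (fun t => ((s - 1) / 2^-1) `^ (s - 1) * expR (- (2^-1 * t)))).
- near=> t; rewrite gamma_integrand_ge0/= gamma_integrand_le//.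
- exact: cvg_cst.
- rewrite -[X in _ --> X](mulr0 (((s - 1) / 2^-1) `^ (s - 1))).
  apply: cvgM; first exact: cvg_cst.
  by apply: cvg_expRMNy; rewrite invr_gt0.
Unshelve. all: by end_near. Qed.

(** * Bounds for the upper incomplete Gamma function *)

(** The key of the first expansion. With g t = t ^ (- a) exp (- t) one has -
    g' = (1 + a / t) g, so g t / (1 + a / t) = t ^ (1 - a) exp (- t) / (t +
    a) would be an antiderivative of - g if the factor t / (t + a) were
    constant; its slow variation only adds the relative error a / (t + a) ^
    2. *)
Lemma is_derive_upper_gamma_antiderivative (R : realType) (a t : R) :
  0 < a -> 0 < t ->
  is_derive t 1 (fun t : R => - (gamma_integrand (2 - a) t * (t + a)^-1))
    (gamma_integrand (1 - a) t * (1 - a / (t + a) ^+ 2)).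
Proof.
move=> a0 t0; have ta0 : t + a != 0 by rewrite gt_eqF// addr_gt0.
have h1 : is_derive t 1 (fun t : R => t + a) 1.
  by apply: is_derive_eq; rewrite addr0.
have h2 := is_derive_expRN t.
have h3 : is_derive t 1 (@powR R ^~ (2 - a - 1))
    ((2 - a - 1) * t `^ (1 - a - 1)).
  have := is_derive1_powR (2 - a - 1) t0.
  by have -> : 2 - a - 1 - 1 = 1 - a - 1 by lra.
have h4 : is_derive t 1 (fun t : R => (t + a)^-1) (- (t + a) ^- 2 *: 1).
  exact: is_deriveV.
have h5 := is_deriveM h3 h2.
have h6 := is_deriveM h5 h4.
have h7 := is_deriveN h6.
apply: (is_derive_eq h7).
rewrite /gamma_integrand !fctE /GRing.scale/=.
have -> : t `^ (2 - a - 1) = t * t `^ (1 - a - 1).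
  have -> : 2 - a - 1 = 1 + (1 - a - 1) by lra.
  by rewrite powRD ?powRr1 ?(ltW t0)// (gt_eqF t0) implybT.
by field; exact: ta0.
Qed.

(** Integrating the almost-antiderivative over [x, +oo[, where the correction
    factor lies between its value at x and 1. *)
Lemma upper_Gamma_bounds (R : realType) (a x : R) : 0 < a -> 0 < x ->
  a < (x + a) ^+ 2 ->
  gamma_integrand (2 - a) x / (x + a) <= upper_Gamma (1 - a) x /\
  upper_Gamma (1 - a) x * (1 - a / (x + a) ^+ 2)
    <= gamma_integrand (2 - a) x / (x + a).
Proof.
move=> a0 x0 axa.
set g := gamma_integrand (1 - a).
set h := gamma_integrand (2 - a) x / (x + a).
set q : R -> R := fun t => 1 - a / (t + a) ^+ 2.
(* q increases on [x, +oo[ and is positive at x, hence q x <= q t <= 1 there *)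
have q_homo t : x <= t -> q x <= q t.
  move=> xt; rewrite lerD2l lerN2 ler_wpM2l ?(ltW a0)//.
  have xa0 : 0 < x + a by rewrite addr_gt0.
  have xta : x + a <= t + a by rewrite lerD2r.
  have ta0 : 0 < t + a by exact: lt_le_trans xta.
  by rewrite lef_pV2 ?posrE ?exprn_gt0// lerXn2r// nnegrE ltW.
have qx0 : 0 < q x.
  by rewrite subr_gt0 ltr_pdivrMr ?mul1r// exprn_gt0// addr_gt0.
have g0 : forall u, 0 <= g u by move=> u; exact: gamma_integrand_ge0.
have gq_cont : forall t : R, 0 < t ->
    {for t, continuous (fun t => g t * q t)}.
  move=> t t0; apply: cvgM; first exact: continuous_gamma_integrand.
  apply: cvgB; first exact: cvg_cst.
  apply: cvgM; first exact: cvg_cst.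
  apply: cvgV; first by rewrite gt_eqF// exprn_gt0// addr_gt0.
  apply: (@cvg_comp _ _ _ (fun t => t + a) (fun t => t ^+ 2)).
    by apply: cvgD; [exact: cvg_id|exact: cvg_cst].
  exact: exprn_continuous.
have dH : forall t : R, 0 < t -> is_derive t 1
    (fun t : R => - (gamma_integrand (2 - a) t * (t + a)^-1)) (g t * q t).
  by move=> t t0; exact: is_derive_upper_gamma_antiderivative.
have intgq : (\int[lebesgue_measure]_(t in `[x, +oo[) (g t * q t)%:E = h%:E)%E.
  rewrite (@ge0_integral_antiderivative R _ _ x 0 _ _ _
    (fun t xt => dH t (lt_trans x0 xt))).
  - by rewrite sub0r opprK.
  - by move=> t xt; rewrite mulr_ge0// (le_trans (ltW qx0))// q_homo.
  - by move=> t xt; apply: gq_cont; exact: lt_trans xt.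
  - exact/cvg_at_right_filter/gq_cont.
  - apply: cvg_at_right_filter.
    have [/derivable1_diffP/differentiable_continuous d _] := dH x x0.
    exact: d.
  - rewrite -[0]oppr0; apply: cvgN.
    (* t ^ (1 - a) <= t <= t + a for t >= 1, so exp (- t) dominates *)
    apply: (@squeeze_cvgr _ _ _ _ (cst 0) (fun t => expR (- t))); last 2 first.
    + exact: cvg_cst.
    + exact: cvgr_expR.
    + near=> t.
      have t1 : 1 <= t by near: t; exact: nbhs_pinfty_ge.
      have t0 : 0 < t by exact: lt_le_trans t1.
      rewrite mulr_ge0 ?gamma_integrand_ge0//=; last first.
        by rewrite invr_ge0 addr_ge0 ?(ltW a0) ?(ltW t0).
      rewrite ler_pdivrMr ?addr_gt0// mulrC ler_wpM2r ?expR_ge0//.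
      apply: (@le_trans _ _ (t `^ 1)); first by apply: ler_powR => //; lra.
      by rewrite powRr1 ?(ltW t0)// lerDl ltW.
have mg D : measurable_fun D (EFin \o g).
  by apply/measurable_EFinP; exact: measurable_gamma_integrand.
have mgq0 : measurable_fun `](0:R), +oo[%classic (fun t => g t * q t).
  apply: open_continuous_measurable_fun => // t; rewrite inE/= in_itv/= andbT.
  exact: gq_cont.
have mgq : measurable_fun `[x, +oo[%classic (EFin \o (fun t => g t * q t)).
  apply/measurable_EFinP; apply: measurable_funS mgq0 => //.
  by move=> t/=; rewrite !in_itv/= !andbT; exact: lt_le_trans.
set I := (\int[lebesgue_measure]_(t in `[x, +oo[) (g t)%:E)%E.
have hI : (h%:E <= I)%E.
  rewrite -intgq; apply: ge0_le_integral => //.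
  - move=> t/=; rewrite in_itv/= andbT => xt.
    by rewrite lee_fin mulr_ge0// (le_trans (ltW qx0))// q_homo.
  - exact: mg.
  - move=> t/=; rewrite in_itv/= andbT => xt.
    rewrite lee_fin ler_piMr// lerBlDr lerDl divr_ge0 ?(ltW a0)//.
    by rewrite exprn_ge0// addr_ge0 ?(ltW a0)// (le_trans (ltW x0)).
have Ih : ((q x)%:E * I <= h%:E)%E.
  rewrite -ge0_integralZl_EFin ?(ltW qx0)//;
    [|by move=> t _; rewrite lee_fin|exact: mg].
  rewrite -intgq; apply: ge0_le_integral => //.
  - by move=> t _; rewrite -EFinM lee_fin mulr_ge0// ltW.
  - by apply: measurable_funeM; exact: mg.
  - move=> t/=; rewrite in_itv/= andbT => xt.
    by rewrite -EFinM lee_fin mulrC ler_wpM2l// q_homo.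
have : upper_Gamma (1 - a) x = fine I by [].
move: hI Ih; case: I => [r| |].
- by rewrite -EFinM !lee_fin /= => hr rh ->; split=> //; rewrite mulrC.
- by rewrite gt0_muley ?lte_fin// leye_eq.
- by rewrite leeNy_eq.
Unshelve. all: by end_near. Qed.

(** * Functional equation and growth of the Gamma function *)

(** The extended-real integral keeps the information on convergence, which
    Gamma, the real-valued integral, forgets. Adding the endpoint 0 does not
    change it. *)
Definition Egamma (R : realType) (s : R) : \bar R :=
  (\int[lebesgue_measure]_(t in `[0%R, +oo[) (gamma_integrand s t)%:E)%E.

Lemma Gamma_Egamma (R : realType) (s : R) : Gamma s = fine (Egamma s).
Proof.
rewrite /Gamma /Rintegral integral_itv_obnd_cbnd//.
by apply/measurable_EFinP; exact: measurable_gamma_integrand.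
Qed.

(** Integration by parts for nonnegative functions only: with A = s t ^ (s -
    1) exp (- t) and B = t ^ s exp (- t), the derivative A - B of B is
    signed, but for an exponential e that dominates A the function B + (e -
    A) is nonnegative and has an antiderivative, and its integral is that of
    e since B vanishes at both ends. *)
Lemma Egamma_fin_num_shift (R : realType) (s : R) : 1 < s ->
  Egamma s \is a fin_num /\ Egamma (s + 1) = (s%:E * Egamma s)%E.
Proof.
move=> s1; have s0 : 0 < s by rewrite (lt_trans _ s1).
(* A <= e by the choice of C; the integral of e is K *)
pose C : R := ((s - 1) / 2^-1) `^ (s - 1).
pose K : R := 2 * (s * C).
have C0 : 0 <= C by exact: powR_ge0.
pose e (t : R) := s * C * expR (- (2^-1 * t)).
pose A t := s * gamma_integrand s t.
pose B := @gamma_integrand R (s + 1).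
have A0 : forall t, 0 <= A t.
  by move=> t; rewrite mulr_ge0 ?(ltW s0) ?gamma_integrand_ge0.
have B0 : forall t, 0 <= B t by move=> t; exact: gamma_integrand_ge0.
have e0 : forall t, 0 <= e t.
  by move=> t; rewrite mulr_ge0 ?expR_ge0// mulr_ge0// ltW.
have Ae : forall t, 0 <= t -> A t <= e t.
  move=> t t0; rewrite /A /e -mulrA ler_wpM2l ?(ltW s0)//.
  exact: gamma_integrand_le.
have E_cont (t : R) :
    {for t, continuous (fun t : R => expR (- (2^-1 * t)) : R)}.
  apply: (@continuous_comp _ _ _ (fun t : R => 2^-1 * t)
    (fun t : R => expR (- t))).
    by apply: cvgM; [exact: cvg_cst|exact: cvg_id].
  exact: cvg_expRN.
have e_cont (t : R) : {for t, continuous e}.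
  by apply: cvgM; [exact: cvg_cst|exact: E_cont].
have dE (t : R) : is_derive t 1 (fun t : R => - K * expR (- (2^-1 * t))) (e t).
  have h := is_deriveZ (- K) (is_derive_expRMN 2^-1 t).
  by apply: (is_derive_eq h); rewrite /e /K /GRing.scale/=; field.
have E_oo : - K * expR (- (2^-1 * t)) @[t --> +oo] --> (0 : R).
  rewrite -[X in _ --> X](mulr0 (- K)); apply: cvgM; first exact: cvg_cst.
  by apply: cvg_expRMNy; rewrite invr_gt0.
have inte : (\int[lebesgue_measure]_(t in `[0%R, +oo[) (e t)%:E = K%:E)%E.
  apply: etrans; first apply: (@ge0_integral_antiderivative R e
      (fun t : R => - K * expR (- (2^-1 * t))) 0 0) => //.
  - exact/cvg_at_right_filter/e_cont.
  - by apply: cvg_at_right_filter; apply: cvgM; [exact: cvg_cst|exact: E_cont].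
  - by rewrite /= mulr0 oppr0 expR0 mulr1 sub0r opprK.
have intBeA : (\int[lebesgue_measure]_(t in `[0%R, +oo[)
    (B t + (e t - A t))%:E = K%:E)%E.
  apply: etrans; first apply: (@ge0_integral_antiderivative R
      (fun t => B t + (e t - A t))
      (fun t : R => - K * expR (- (2^-1 * t)) - B t) 0 0).
  - by move=> t t0; rewrite addr_ge0// subr_ge0 Ae.
  - move=> t t0; apply: cvgD; first exact: continuous_gamma_integrand.
    apply: cvgB; first exact: e_cont.
    by apply: cvgM; [exact: cvg_cst|exact: continuous_gamma_integrand].
  - apply: cvgD; first by apply: gamma_integrand_cvg0; rewrite ltrDr.
    apply: cvgB; first exact/cvg_at_right_filter/e_cont.
    by apply: cvgM; [exact: cvg_cst|exact: gamma_integrand_cvg0].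
  - move=> t t0; have h := is_deriveB (dE t) (is_derive_gamma_integrand s t0).
    by apply: (is_derive_eq h); rewrite /A /B; ring.
  - apply: cvgB; last by apply: gamma_integrand_cvg0; rewrite ltrDr.
    by apply: cvg_at_right_filter; apply: cvgM; [exact: cvg_cst|exact: E_cont].
  - rewrite -[X in _ --> X](subrr (0:R)); apply: cvgB => //.
    by apply: gamma_integrand_cvgy; rewrite ltrDr.
  - rewrite /= mulr0 oppr0 expR0 mulr1 sub0r opprB /B /gamma_integrand addrK.
    by rewrite powR0 ?gt_eqF// mul0r sub0r opprK.
have mA D : measurable_fun D (EFin \o A).
  apply/measurable_EFinP/measurable_funM => //.
  exact: measurable_gamma_integrand.
have mB D : measurable_fun D (EFin \o B).
  by apply/measurable_EFinP; exact: measurable_gamma_integrand.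
have me D : measurable_fun D (EFin \o e).
  apply/measurable_EFinP; apply: measurable_funTS.
  exact: continuous_measurable_fun.
have meA D : measurable_fun D (fun t => (e t - A t)%:E).
  apply: (emeasurable_funB (me D) (mA D)).
(* Comparing eA and eB cancels the finite IeA: Egamma (s + 1) = IA. *)
set IA := (\int[lebesgue_measure]_(t in `[0%R, +oo[) (A t)%:E)%E.
set IeA := (\int[lebesgue_measure]_(t in `[0%R, +oo[) (e t - A t)%:E)%E.
have eA : (IA + IeA = K%:E)%E.
  rewrite -inte -ge0_integralD//.
  - by apply: eq_integral => t _; rewrite -EFinD addrC subrK.
  - by move=> t _; rewrite lee_fin.
  - exact: mA.
  - by move=> t/=; rewrite in_itv/= andbT => t0; rewrite lee_fin subr_ge0 Ae.
  - exact: meA.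
have eB : (Egamma (s + 1) + IeA = K%:E)%E.
  rewrite -intBeA -ge0_integralD//.
  - by move=> t _; rewrite lee_fin.
  - exact: mB.
  - by move=> t/=; rewrite in_itv/= andbT => t0; rewrite lee_fin subr_ge0 Ae.
  - exact: meA.
have IAE : (IA = s%:E * Egamma s)%E.
  rewrite -ge0_integralZl_EFin ?(ltW s0)//.
  - by move=> t _; rewrite lee_fin gamma_integrand_ge0.
  - by apply/measurable_EFinP; exact: measurable_gamma_integrand.
have IeA0 : (0 <= IeA)%E.
  apply: integral_ge0 => t/=; rewrite in_itv/= andbT => t0.
  by rewrite lee_fin subr_ge0 Ae.
have EG0 : (0 <= Egamma s)%E.
  by apply: integral_ge0 => t _; rewrite lee_fin gamma_integrand_ge0.
rewrite {}IAE in eA; move: eA eB IeA0 EG0.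
case: (Egamma s) => [r| |]; case: IeA => [i| |] //=; last 2 first.
- by rewrite gt0_muley ?lte_fin.
- by rewrite gt0_muley ?lte_fin.
case: (Egamma (s + 1)) => [v| |]// [ea] [eb] _ _; split=> //.
by rewrite -EFinM; congr (_%:E); lra.
Qed.

Lemma Egamma_Gamma (R : realType) (s : R) : 1 < s -> Egamma s = (Gamma s)%:E.
Proof.
by move=> s1; rewrite Gamma_Egamma fineK//; have [] := Egamma_fin_num_shift s1.
Qed.

Lemma GammaS (R : realType) (s : R) : 1 < s -> Gamma (s + 1) = s * Gamma s.
Proof.
move=> s1; have [_] := Egamma_fin_num_shift s1.
by rewrite !Egamma_Gamma ?ltr_wpDr// -EFinM => -[].
Qed.

(** On [1, +oo[ the integrand is at least exp (- t). *)
Lemma Gamma_gt0 (R : realType) (s : R) : 1 < s -> 0 < Gamma s.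
Proof.
move=> s1; rewrite -lte_fin -Egamma_Gamma//.
have int_expR : (\int[lebesgue_measure]_(t in `[1%R, +oo[) (expR (- t))%:E
    = (expR (-1) : R)%:E)%E.
  apply: etrans; first apply: (@ge0_integral_antiderivative R
      (fun t => expR (- t))
      (fun t : R => - expR (- t)) 1 0).
  - by move=> t _; exact: expR_ge0.
  - by move=> t _; exact: cvg_expRN.
  - exact/cvg_at_right_filter/cvg_expRN.
  - move=> t _; have h := is_deriveN (is_derive_expRN t).
    by apply: (is_derive_eq h); rewrite opprK.
  - apply: cvg_at_right_filter; apply: cvgN; exact: cvg_expRN.
  - by rewrite -[X in _ --> X]oppr0; apply: cvgN; exact: cvgr_expR.
  - by rewrite /= sub0r opprK.
apply: (@lt_le_trans _ _ (expR (-1) : R)%:E); first by rewrite lte_fin expR_gt0.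
have mg D : measurable_fun D (EFin \o @gamma_integrand R s).
  by apply/measurable_EFinP; exact: measurable_gamma_integrand.
apply: (@le_trans _ _ (\int[lebesgue_measure]_(t in `[1%R, +oo[)
    (gamma_integrand s t)%:E)%E).
  rewrite -int_expR; apply: ge0_le_integral => //.
  - apply/measurable_EFinP; apply: measurable_funTS.
    by apply: measurableT_comp => //; exact: measurableT_comp.
  - exact: mg.
  - move=> t/=; rewrite in_itv/= andbT => t1; rewrite lee_fin.
    rewrite ler_peMl ?expR_ge0//.
    by rewrite -[leLHS](powRr0 t) ler_powR// subr_ge0 ltW.
apply: ge0_subset_integral => //.
- exact: mg.
- by move=> t _; rewrite lee_fin gamma_integrand_ge0.
- by move=> t/=; rewrite !in_itv/= !andbT; exact: le_trans.
Qed.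

(** The tangent inequality for t ^ c at t = s, multiplied by the integrand. *)
Lemma gamma_integrand_le_chord (R : realType) (s c t : R) :
  1 < s -> 0 <= c <= 1 -> 0 <= t ->
  gamma_integrand (s + c) t <=
    s `^ c * (1 - c) * gamma_integrand s t
    + s `^ c * (c / s) * gamma_integrand (s + 1) t.
Proof.
move=> s1 /[dup] c01 /andP[c0 c1]; have s0 : 0 < s by rewrite (lt_trans _ s1).
rewrite le_eqVlt => /predU1P[<-|t0].
  rewrite {1}/gamma_integrand powR0 ?mul0r; last by rewrite gt_eqF//; lra.
  have k1 : 0 <= s `^ c * (1 - c) by rewrite mulr_ge0 ?powR_ge0 ?subr_ge0.
  have k2 : 0 <= s `^ c * (c / s).
    by rewrite mulr_ge0 ?powR_ge0 ?divr_ge0 ?(ltW s0).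
  by apply: addr_ge0; apply: mulr_ge0 => //; exact: gamma_integrand_ge0.
have -> : gamma_integrand (s + c) t =
    s `^ c * (t / s) `^ c * gamma_integrand s t.
  rewrite -powRM ?divr_ge0 ?(ltW s0) ?(ltW t0)//
    [s * (t / s)]mulrC divfK ?gt_eqF//.
  rewrite /gamma_integrand mulrA; congr (_ * _).
  have -> : s + c - 1 = c + (s - 1) by ring.
  by rewrite (@powRD _ t c) ?(gt_eqF t0) ?implybT.
have h := powR_le_tangent c01 (divr_gt0 t0 s0).
rewrite gamma_integrandS//.
apply: (@le_trans _ _ (s `^ c * (1 - c + c * (t / s)) * gamma_integrand s t)).
  apply: ler_wpM2r; first exact: gamma_integrand_ge0.
  by apply: ler_wpM2l => //; exact: powR_ge0.
by rewrite le_eqVlt; apply/orP; left; apply/eqP; ring.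
Qed.

(** The point t = s is chosen so that the two terms of the chord integrate,
    by Gamma (s + 1) = s Gamma s, to multiples 1 - c and c of the same
    number. *)
Lemma Gamma_le_powR (R : realType) (s c : R) : 1 < s -> 0 <= c <= 1 ->
  Gamma (s + c) <= s `^ c * Gamma s.
Proof.
move=> s1 /[dup] c01 /andP[c0 c1]; have s0 : 0 < s by rewrite (lt_trans _ s1).
have mg u D : measurable_fun D (EFin \o @gamma_integrand R u).
  by apply/measurable_EFinP; exact: measurable_gamma_integrand.
have k1 : 0 <= s `^ c * (1 - c) by rewrite mulr_ge0 ?powR_ge0 ?subr_ge0.
have k2 : 0 <= s `^ c * (c / s).
  by rewrite mulr_ge0 ?powR_ge0 ?divr_ge0 ?(ltW s0).
have sc1 : 1 < s + c by lra.
have s11 : 1 < s + 1 by lra.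
have Zg k u : 0 <= k -> (\int[lebesgue_measure]_(t in `[0%R, +oo[)
    (k%:E * (@gamma_integrand R u t)%:E) = k%:E * Egamma u)%E.
  move=> k0; apply: ge0_integralZl_EFin => //; last exact: mg.
  by move=> t _; rewrite lee_fin gamma_integrand_ge0.
have kg k u (t : R) : 0 <= k -> (0 <= k%:E * (gamma_integrand u t)%:E)%E.
  by move=> k0; apply: mule_ge0; rewrite lee_fin// gamma_integrand_ge0.
have key : (Egamma (s + c)%R <= (s `^ c * (1 - c))%:E * Egamma s
    + (s `^ c * (c / s))%:E * Egamma (s + 1)%R)%E.
  rewrite -!Zg// -ge0_integralD//; last 4 first.
  - by move=> t _; exact: kg.
  - by apply: measurable_funeM; exact: mg.
  - by move=> t _; exact: kg.
  - by apply: measurable_funeM; exact: mg.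
  apply: ge0_le_integral => //.
  - by move=> t _; rewrite lee_fin gamma_integrand_ge0.
  - exact: mg.
  - by apply: emeasurable_funD; apply: measurable_funeM; exact: mg.
  - move=> t/=; rewrite in_itv/= andbT => t0; rewrite -!EFinM -EFinD lee_fin.
    exact: gamma_integrand_le_chord.
move: key; rewrite (Egamma_Gamma sc1) (Egamma_Gamma s1) (Egamma_Gamma s11).
rewrite (GammaS s1); move: (Gamma (s + c)) (Gamma s) => u v.
rewrite -!EFinM -EFinD lee_fin => /le_trans; apply.
by rewrite le_eqVlt; apply/orP; left; apply/eqP; field; rewrite gt_eqF.
Qed.

(** * Ratios of shifted values *)

(** The three properties of the Gamma function that determine the second
    expansion. Keeping G abstract also keeps its integral out of the algebra. *)
Definition Wendel_function (R : realType) (G : R -> R) : Prop :=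
  [/\ forall s, 1 < s -> 0 < G s,
      forall s, 1 < s -> G (s + 1) = s * G s
    & forall s c, 1 < s -> 0 <= c <= 1 -> G (s + c) <= s `^ c * G s].

Lemma Wendel_Gamma (R : realType) : Wendel_function (@Gamma R).
Proof.
by split=> [s|s|s c]; [exact: Gamma_gt0|exact: GammaS|exact: Gamma_le_powR].
Qed.

(** For c = 1 / p and s = (n - 1) / p this is the quotient subtracted from 1
    in f2. *)
Definition shift_ratio (R : realType) (G : R -> R) (c s : R) : R :=
  G (s + c) * G (s + 1 - c) / (s * G s ^+ 2).

Lemma shift_ratio_le1 (R : realType) (G : R -> R) (c s : R) :
  Wendel_function G -> 0 <= c <= 1 -> 1 < s ->
  shift_ratio G c s <= 1.
Proof.
move=> /[dup] WG [Gp GS GW] /[dup] c01 /andP[c0 c1] s1.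
have s0 : 0 < s by lra.
have d01 : 0 <= 1 - c <= 1 by apply/andP; split; lra.
have G0 := Gp _ s1.
have Gc := Gp _ (ltr_wpDr c0 s1).
have h1 := GW _ _ s1 c01.
have h2 := GW _ _ s1 d01; rewrite addrA in h2.
rewrite ler_pdivrMr ?mul1r; last by rewrite mulr_gt0// exprn_gt0.
have -> : s * G s ^+ 2 = (s `^ c * G s) * (s `^ (1 - c) * G s).
  rewrite mulrACA -(@powRD _ s) ?(gt_eqF s0) ?implybT//.
  by rewrite addrC subrK powRr1 ?(ltW s0).
apply: ler_pM => //; first exact: ltW.
by apply: ltW; apply: Gp; lra.
Qed.

(** The upper bound of G (t + c) is used at t = s + c and t = s + 1 - c, with
    the shifts 1 - c and c that lead from there to s + 1. *)
Lemma shift_ratio_ge (R : realType) (G : R -> R) (c s : R) :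
  Wendel_function G -> 0 <= c <= 1 -> 1 < s ->
  s / (s + 1) <= shift_ratio G c s.
Proof.
move=> /[dup] WG [Gp GS GW] /[dup] c01 /andP[c0 c1] s1.
have s0 : 0 < s by lra.
have d01 : 0 <= 1 - c <= 1 by apply/andP; split; lra.
have G0 := Gp _ s1.
have sc1 : 1 < s + c by lra.
have sd1 : 1 < s + 1 - c by lra.
have s10 : 0 < s + 1 by lra.
have Gc := Gp _ sc1.
have Gd := Gp _ sd1.
have h1 := GW _ _ sc1 d01.
have h2 := GW _ _ sd1 c01.
have E1 : s + c + (1 - c) = s + 1 by ring.
have E2 : s + 1 - c + c = s + 1 by ring.
rewrite {}E1 (GS _ s1) in h1; rewrite {}E2 (GS _ s1) in h2.
have k1 : s * G s <= (s + 1) `^ (1 - c) * G (s + c).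
  apply: (le_trans h1); apply: ler_wpM2r; first exact: ltW.
  by apply: ge0_ler_powR; rewrite ?nnegrE; lra.
have k2 : s * G s <= (s + 1) `^ c * G (s + 1 - c).
  apply: (le_trans h2); apply: ler_wpM2r; first exact: ltW.
  by apply: ge0_ler_powR; rewrite ?nnegrE; lra.
have sG : 0 <= s * G s by rewrite mulr_ge0 ?ltW.
have k3 := ler_pM sG sG k1 k2.
have e1 : (s + 1) `^ (1 - c) * (s + 1) `^ c = s + 1.
  by rewrite -(@powRD _ (s + 1)) ?(gt_eqF s10) ?implybT// subrK powRr1 ?ltW.
rewrite [leRHS]mulrACA e1 in k3.
rewrite /shift_ratio ler_pdivlMr; last by rewrite mulr_gt0// exprn_gt0.
rewrite mulrAC ler_pdivrMr// [leRHS]mulrC.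
by apply: le_trans k3; rewrite le_eqVlt; apply/orP; left; apply/eqP; ring.
Qed.

(** The shift by 1 multiplies the ratio by (s + c) (s + 1 - c) / (s (s + 1)). *)
Lemma shift_ratioS (R : realType) (G : R -> R) (c s : R) :
  Wendel_function G -> 0 <= c <= 1 -> 1 < s ->
  shift_ratio G c (s + 1) =
    shift_ratio G c s * (1 + c * (1 - c) / (s * (s + 1))).
Proof.
move=> [Gp GS GW] /andP[c0 c1] s1.
have G0 := Gp _ s1.
have sc1 : 1 < s + c by lra.
have sd1 : 1 < s + 1 - c by lra.
rewrite /shift_ratio.
have -> : s + 1 + c = s + c + 1 by ring.
have -> : s + 1 + 1 - c = s + 1 - c + 1 by ring.
rewrite !GS//; field.
by rewrite !gt_eqF//; lra.
Qed.

Lemma le_of_forall_natSinv (R : realType) (x y : R) :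
  (forall k : nat, x <= y + k.+1%:R^-1) -> x <= y.
Proof.
move=> h; apply/ler_addgt0Pr => e e0.
have [N _ hN] := near_infty_natSinv_lt (PosNum e0).
by apply: (le_trans (h N)); rewrite lerD2l ltW//; exact: (hN N (leqnn N)).
Qed.

Lemma homo_shift (R : realType) (u : R -> R) :
  (forall s, 1 < s -> u s <= u (s + 1)) ->
  forall (k : nat) s, 1 < s -> u s <= u (s + k%:R).
Proof.
move=> h; elim=> [s _|k IH s s1]; first by rewrite addr0.
apply: (le_trans (IH s s1)); rewrite -[k.+1]addn1 natrD addrA; apply: h.
by rewrite ltr_wpDr.
Qed.

(** Multiplied by 1 + d / s, with d = c (1 - c), the ratio increases along s,
    s + 1, s + 2, ..., and the product has a limit at most 1. *)
Lemma shift_ratio_upper (R : realType) (G : R -> R) (c s : R) :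
  Wendel_function G -> 0 <= c <= 1 -> 1 < s ->
  shift_ratio G c s <= s / (s + c * (1 - c)).
Proof.
move=> /[dup] WG [Gp GS GW] /[dup] c01 /andP[c0 c1] s1; set d := c * (1 - c).
have d0 : 0 <= d by rewrite mulr_ge0 ?subr_ge0.
have d1 : d <= 1 by rewrite /d; nra.
pose u s := shift_ratio G c s * (1 + d / s).
have ratio0 t : 1 < t -> 0 <= shift_ratio G c t.
  move=> t1; apply: le_trans (shift_ratio_ge WG c01 t1).
  by rewrite divr_ge0//; lra.
have uS t : 1 < t -> u t <= u (t + 1).
  move=> t1; rewrite /u shift_ratioS// -/d -mulrA; apply: ler_wpM2l.
    exact: ratio0.
  rewrite -subr_ge0.
  have -> : (1 + d / (t * (t + 1))) * (1 + d / (t + 1)) - (1 + d / t)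
     = d ^+ 2 / (t * (t + 1) ^+ 2).
    by field; rewrite !gt_eqF//; lra.
  by rewrite divr_ge0 ?exprn_ge0// mulr_ge0 ?exprn_ge0//; lra.
have s0 : 0 < s by lra.
suff : u s <= 1.
  rewrite /u => h; rewrite ler_pdivlMr; last by lra.
  have -> : shift_ratio G c s * (s + d) = shift_ratio G c s * (1 + d / s) * s.
    by field; rewrite gt_eqF.
  by rewrite ler_piMl// ltW.
apply: le_of_forall_natSinv => k.
apply: (le_trans (homo_shift uS k s1)).
have k0 : (0 : R) <= k%:R by [].
have sk1 : 1 < s + k%:R by lra.
have r1 := shift_ratio_le1 WG c01 sk1.
apply: (@le_trans _ _ (1 + d / (s + k%:R))).
  by rewrite /u ler_piMl// addr_ge0// divr_ge0//; lra.
rewrite lerD2l ler_pdivrMr; last by lra.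
by rewrite -natr1 mulrC ler_pdivlMr; [nra|lra].
Qed.

(** Multiplied by s / (s - d), with d = c (1 - c), the ratio decreases along
    s, s + 1, s + 2, ..., and stays above (s + k) / (s + k + 1), which tends
    to 1. *)
Lemma shift_ratio_lower (R : realType) (G : R -> R) (c s : R) :
  Wendel_function G -> 0 <= c <= 1 -> 1 < s ->
  1 - c * (1 - c) / s <= shift_ratio G c s.
Proof.
move=> /[dup] WG [Gp GS GW] /[dup] c01 /andP[c0 c1] s1; set d := c * (1 - c).
have d0 : 0 <= d by rewrite mulr_ge0 ?subr_ge0.
have d1 : d <= 1 by rewrite /d; nra.
pose u s := - (shift_ratio G c s * (s / (s - d))).
have ratio0 t : 1 < t -> 0 <= shift_ratio G c t.
  move=> t1; apply: le_trans (shift_ratio_ge WG c01 t1).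
  by rewrite divr_ge0//; lra.
have uS t : 1 < t -> u t <= u (t + 1).
  move=> t1; rewrite /u lerN2 shift_ratioS// -/d -mulrA; apply: ler_wpM2l.
    exact: ratio0.
  rewrite -subr_ge0.
  have -> : t / (t - d) - (1 + d / (t * (t + 1))) * ((t + 1) / (t + 1 - d))
     = d ^+ 2 / (t * (t - d) * (t + 1 - d)).
    by field; rewrite !gt_eqF//; lra.
  by rewrite divr_ge0 ?exprn_ge0// !mulr_ge0//; lra.
have s0 : 0 < s by lra.
suff : 1 <= - u s.
  rewrite /u opprK => h.
  have -> : 1 - d / s = (s - d) / s by field; rewrite gt_eqF.
  rewrite ler_pdivrMr//.
  move: h; rewrite mulrA ler_pdivlMr ?mul1r//; lra.
rewrite -lerN2 opprK.
apply: le_of_forall_natSinv => k.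
apply: (le_trans (homo_shift uS k s1)).
have k0 : (0 : R) <= k%:R by [].
have sk1 : 1 < s + k%:R by lra.
have r1 := shift_ratio_ge WG c01 sk1.
have r0 := ratio0 _ sk1.
rewrite /u; set t := s + k%:R in sk1 r1 r0 *.
have h1 : shift_ratio G c t <= shift_ratio G c t * (t / (t - d)).
  by rewrite ler_peMr// ler_pdivlMr; lra.
have h2 : t / (t + 1) = 1 - (t + 1)^-1 by field; rewrite gt_eqF//; lra.
have h3 : (t + 1)^-1 <= k.+1%:R^-1.
  by rewrite lef_pV2 ?posrE// -?natr1 /t; lra.
rewrite h2 in r1; have h4 := le_trans r1 h1.
apply: (@le_trans _ _ (-1 + (t + 1)^-1)); last by rewrite lerD2l.
by move: h4; set x := _ * (t / _); set y := (t + 1)^-1; lra.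
Qed.

(** * The two expansions *)

(** Both expansions have an error of order 1 / n ^ 2, with an explicit bound. *)
Lemma eqaddo_natV (R : realType) (f g : nat -> R) (N : nat) :
  (forall n, (N <= n)%N -> 0 <= f n - g n <= n%:R^-1 * n.-1%:R^-1) ->
  f = g +o_ \oo (fun n : nat => n%:R^-1 : R).
Proof.
move=> H; apply/eqaddoP => e e0.
have [M _ hM] := near_infty_natSinv_lt (PosNum e0).
near=> n.
have nN : (N <= n)%N by near: n; exists N.
have nM : (M.+2 <= n)%N by near: n; exists M.+2.
have {nN} := H n nN; move: (n) nM => [|[|m]]// mM /andP[h0 h1].
rewrite [leLHS]ger0_norm// ger0_norm ?invr_ge0//.
apply: (le_trans h1); rewrite mulrC ler_wpM2r ?invr_ge0//.
by apply/ltW/hM; rewrite /= -ltnS.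
Unshelve. all: by end_near. Qed.

(** The factors in front of upper_Gamma cancel the powers and exponentials of
    the bounds; what remains is (p - 1) / (n p) and the same divided by 1 - 1
    / (n p). The factor (p - 1) / p in the error is kept for the limit at p =
    1. *)
Lemma f1_formula_bounds (R : realType) (p : R) (n : nat) :
  1 < p -> (2 <= n)%N ->
  0 <= f1_formula p n - (p - 1) / (n%:R * p)
    <= (p - 1) / p * (n%:R^-1 * n.-1%:R^-1).
Proof.
move=> p1 n2.
have n2R : (2 : R) <= n%:R by rewrite ler_nat.
have nE : n.-1%:R = n%:R - 1 :> R by rewrite -subn1 natrB// ltnW.
rewrite nE /f1_formula; set N : R := n%:R in n2R *; clearbody N; clear nE.
have p0 : 0 < p by lra.
have N0 : 0 < N by lra.
(* x + a = N is what makes the bounds on upper_Gamma explicit *)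
set x := (p - 1) * N / p; set a := N / p.
have a0 : 0 < a by rewrite divr_gt0.
have x0 : 0 < x by rewrite divr_gt0// mulr_gt0//; lra.
have xaN : x + a = N by rewrite /x /a; field; rewrite gt_eqF.
have aN : a < (x + a) ^+ 2.
  rewrite xaN /a ltr_pdivrMr//; nra.
have [] := upper_Gamma_bounds a0 x0 aN.
rewrite xaN; move: (upper_Gamma (1 - a) x) => U.
set h := gamma_integrand _ _ / _ => hU Uh.
set w := N^-1 * expR x * x `^ a.
have w0 : 0 < w by rewrite !mulr_gt0 ?invr_gt0 ?expR_gt0 ?powR_gt0.
have wh : w * h = (p - 1) / (N * p).
  have e1 : x `^ a * x `^ (2 - a - 1) = x.
    rewrite -(@powRD _ x a) ?(gt_eqF x0) ?implybT//.
    have -> : a + (2 - a - 1) = 1 by ring.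
    by rewrite powRr1 ?(ltW x0).
  have e2 : expR x * expR (- x) = 1 by rewrite expRxMexpNx_1.
  transitivity
    (N^-1 * (expR x * expR (- x)) * (x `^ a * x `^ (2 - a - 1)) / N).
    by rewrite /w /h /gamma_integrand; ring.
  by rewrite e1 e2 /x; field; rewrite !gt_eqF.
have q0 : 0 < N * p - 1 by nra.
have qE : 1 - a / N ^+ 2 = (N * p - 1) / (N * p).
  by rewrite /a; field; rewrite !gt_eqF.
rewrite qE in Uh.
clearbody h w; rewrite -wh -mulrBr; apply/andP; split.
  by rewrite mulr_ge0 ?subr_ge0// ltW.
have U2 : U <= h * (N * p) / (N * p - 1).
  rewrite ler_pdivlMr//; move: Uh; rewrite mulrA ler_pdivrMr//.
  by rewrite mulr_gt0.
apply: (@le_trans _ _ (w * (h * (N * p) / (N * p - 1) - h))).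
  by rewrite ler_wpM2l ?(ltW w0)// lerD2r.
have -> : w * (h * (N * p) / (N * p - 1) - h) = w * h / (N * p - 1).
  by field; rewrite gt_eqF.
rewrite wh.
have -> : (p - 1) / (N * p) / (N * p - 1) =
    (p - 1) / p * (N^-1 * (N * p - 1)^-1).
  by field; rewrite !gt_eqF.
apply: ler_wpM2l; first by rewrite divr_ge0; lra.
apply: ler_wpM2l; first by rewrite invr_ge0; lra.
by rewrite lef_pV2 ?posrE//; nra.
Qed.

Lemma f1_formula_cvg (R : realType) (n : nat) : (2 <= n)%N ->
  f1_formula q n @[q --> (1 : R)^'+] --> (0 : R).
Proof.
move=> n2; pose K : R := 1 + n%:R^-1 * n.-1%:R^-1.
have n1 : (1 : R) <= n%:R by rewrite ler1n ltnW.
apply: (@squeeze_cvgr _ _ _ _ (cst 0) (fun q : R => (q - 1) * K)).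
- near=> q.
  have q1 : 1 < q by near: q; exact: nbhs_right_gt.
  have /andP[h0 h1] := f1_formula_bounds q1 n2.
  have m0 : 0 <= (q - 1) / (n%:R * q) by rewrite divr_ge0 ?mulr_ge0//; lra.
  have m1 : (q - 1) / (n%:R * q) <= q - 1.
    have Nq : 1 <= n%:R * q by nra.
    by rewrite ler_pdivrMr ?(lt_le_trans ltr01 Nq)// ler_peMr//; lra.
  have m2 : (q - 1) / q * (n%:R^-1 * n.-1%:R^-1)
      <= (q - 1) * (n%:R^-1 * n.-1%:R^-1).
    by rewrite ler_wpM2r ?mulr_ge0 ?invr_ge0// ler_pdivrMr; nra.
  rewrite /K mulrDr mulr1.
  apply/andP; split; first by apply: (le_trans m0); rewrite -subr_ge0.
  by apply: le_trans (lerD m1 m2); rewrite -lerBlDl.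
- exact: cvg_cst.
- have -> : (0 : R) = (1 - 1) * K by rewrite subrr mul0r.
  apply: cvg_at_right_filter; apply: cvgM; last exact: cvg_cst.
  by apply: cvgB; [exact: cvg_id|exact: cvg_cst].
Unshelve. all: by end_near. Qed.

(** The bounds of the ratio give (p - 1) / (n p - 1) <= f2 p n <= (p - 1) /
    (p (n - 1)). *)
Lemma f2_bounds (R : realType) (p : R) (n : nat) :
  1 <= p -> p + 1 < n%:R ->
  0 <= f2 p n - (p - 1) / (n%:R * p) <= n%:R^-1 * n.-1%:R^-1.
Proof.
move=> p1 pn.
have n0 : (0 < n)%N by rewrite -(ltr_nat R); lra.
have nE : n.-1%:R = n%:R - 1 :> R by rewrite -subn1 natrB.
rewrite nE /f2; set N : R := n%:R in pn *; clearbody N; clear nE.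
have p0 : 0 < p by lra.
pose s := (N - 1) / p; pose c := p^-1.
have s1 : 1 < s by rewrite ltr_pdivlMr//; lra.
have c01 : 0 <= c <= 1 by rewrite invr_ge0 ltW//= invf_le1.
have e1 : (N + p - 2) / p = s + 1 - c by rewrite /s /c; field; rewrite gt_eqF.
have e2 : N / p = s + c by rewrite /s /c; field; rewrite gt_eqF.
have -> : 1 - p / (N - 1) * (Gamma ((N + p - 2) / p) * Gamma (N / p)
    / Gamma ((N - 1) / p) ^+ 2) = 1 - shift_ratio (@Gamma R) c s.
  have G0 := Gamma_gt0 s1.
  rewrite e1 e2 -/s /shift_ratio.
  have -> : p / (N - 1) = s^-1 by rewrite /s invf_div.
  move: (Gamma (s + c)) (Gamma (s + 1 - c)) (Gamma s) G0 => A B C C0.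
  by field; rewrite !gt_eqF//; lra.
have := shift_ratio_upper (Wendel_Gamma R) c01 s1.
have := shift_ratio_lower (Wendel_Gamma R) c01 s1.
move: (shift_ratio _ _ _) => r.
have -> : c * (1 - c) / s = (p - 1) / p / (N - 1).
  by rewrite /s /c; field; rewrite !gt_eqF//; lra.
have -> : s / (s + c * (1 - c)) = 1 - (p - 1) / (N * p - 1).
  rewrite /s /c; field; rewrite !gt_eqF//; nra.
move=> rl ru; apply/andP; split.
  have : (p - 1) / (N * p) <= (p - 1) / (N * p - 1).
    by apply: ler_wpM2l; [lra|rewrite lef_pV2 ?posrE; nra].
  by move: ru; move: (_ / (N * p)) (_ / (N * p - 1)) => u v; lra.
have h : (p - 1) / p / (N - 1) - (p - 1) / (N * p) =
    (p - 1) / p * (N^-1 * (N - 1)^-1).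
  by field; rewrite !gt_eqF//; lra.
apply: (@le_trans _ _ ((p - 1) / p * (N^-1 * (N - 1)^-1))).
  rewrite -h; move: rl; move: (_ / p / _) (_ / (N * p)) => u v; lra.
rewrite ler_piMl//; first by rewrite mulr_ge0// invr_ge0; lra.
by rewrite ler_pdivrMr//; lra.
Qed.

Theorem mainTheorem3 (R : realType) (p : R) (hp : 1 <= p) :
  [/\ (forall n : nat, (2 <= n)%N ->
         f1_formula q n @[q --> (1 : R)^'+] --> (0 : R)),
      f1 p
        = (fun n : nat => (p - 1) / (n%:R * p))
          +o_ \oo (fun n : nat => n%:R^-1 : R)
    & f2 p
        = (fun n : nat => (p - 1) / (n%:R * p))
          +o_ \oo (fun n : nat => n%:R^-1 : R)].
Proof.
have p0 : 0 < p by lra.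
split; first exact: f1_formula_cvg.
- apply: (@eqaddo_natV _ _ _ 2) => n n2; rewrite /f1; case: eqP => [->|/eqP p1].
    rewrite subrr mul0r (cvg_lim _ (f1_formula_cvg n2))// subr0 lexx/=.
    by rewrite mulr_ge0 ?invr_ge0.
  have {}p1 : 1 < p by rewrite lt_neqAle eq_sym p1.
  have /andP[-> /le_trans ->//] := f1_formula_bounds p1 n2.
  by rewrite ler_piMl ?mulr_ge0 ?invr_ge0// ler_pdivrMr//; lra.
- have pN : p + 1 < (Num.bound (p + 1))%:R by apply: archi_boundP; lra.
  apply: (eqaddo_natV (N := Num.bound (p + 1))) => n Nn; apply: f2_bounds => //.
  by apply: (lt_le_trans pN); rewrite ler_nat.
Qed.
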